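(* The generating function $GM(z)=\sum_{j=0}^{\infty}GM_j z^j$ of the Gaussian Mersenne numbers is (as a formal power series over $\mathbb{C}$) $$GM(z)=\frac{z+i\left(\frac{3}{2}z-\frac{1}{2}\right)}{1-3z+2z^2}.$$
   Context: The Gaussian Mersenne sequence $(GM_k)_{k\ge 0}$ of complex numbers is defined by $GM_0=-\frac{i}{2}$, $GM_1=1$ and $GM_{k+2}=3GM_{k+1}-2GM_k$ for $k\ge 0$, where $i$ is the imaginary unit. *)

(* Defs.v *)
From HB Require Import structures.
From mathcomp Require Import all_boot all_order all_algebra.
From mathcomp Require Import boolp reals.
From mathcomp Require Import complex.

Set Implicit Arguments.
Unset Strict Implicit.
Unset Printing Implicit Defensive.

Import GRing.Theory.
Local Open Scope ring_scope.

(** The commutative ring R[[z]] of formal power series: coefficient sequences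
    with termwise addition and the Cauchy product.  A wrapper around [nat -> R]
    is used because functions into a ring may already carry the pointwise ring
    structure. *)
Record fps (R : Type) := Fps { fps_coef : nat -> R }.

Notation "{ 'fps' R }" := (fps R) (at level 0, format "{ 'fps'  R }").
Notation "\fps_ j E" := (Fps (fun j : nat => E))
  (at level 34, j name, E at level 39, format "\fps_ j  E").

HB.instance Definition _ (R : Type) := gen_eqMixin {fps R}.
HB.instance Definition _ (R : Type) := gen_choiceMixin {fps R}.

Lemma fpsP (R : Type) (f g : {fps R}) :
  (forall n, fps_coef f n = fps_coef g n) <-> f = g.
Proof.
split=> [|-> //]; case: f g => [f] [g] /= fg.
by congr Fps; apply/funext.
Qed.

Section FpsRing.
Variable R : comUnitRingType.
Implicit Types f g h : {fps R}.

Definition fpsC (c : R) : {fps R} := \fps_n (if n == 0%N then c else 0).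
Definition fpsX : {fps R} := \fps_n (n == 1%N)%:R.

Definition fps_opp f : {fps R} := \fps_n (- fps_coef f n).
Definition fps_add f g : {fps R} := \fps_n (fps_coef f n + fps_coef g n).
Definition fps_mul f g : {fps R} :=
  \fps_n (\sum_(i < n.+1) fps_coef f i * fps_coef g (n - i)).

Lemma fps_addA : associative fps_add.
Proof. by move=> f g h; apply/fpsP => n /=; rewrite addrA. Qed.

Lemma fps_addC : commutative fps_add.
Proof. by move=> f g; apply/fpsP => n /=; rewrite addrC. Qed.

Lemma fps_add0 : left_id (fpsC 0) fps_add.
Proof. by move=> f; apply/fpsP => n /=; rewrite if_same add0r. Qed.

Lemma fps_addN : left_inverse (fpsC 0) fps_opp fps_add.
Proof. by move=> f; apply/fpsP => n /=; rewrite if_same addNr. Qed.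

HB.instance Definition _ := GRing.isZmodule.Build {fps R}
  fps_addA fps_addC fps_add0 fps_addN.

Let trunc m f : {poly R} := \poly_(i < m) fps_coef f i.

Let fps_mulE m n f g : (n < m)%N ->
  fps_coef (fps_mul f g) n = (trunc m f * trunc m g)`_n.
Proof.
move=> ltnm; rewrite coefM /=; apply: eq_bigr => i _.
rewrite !coef_poly (leq_ltn_trans _ ltnm) ?(leq_ltn_trans _ ltnm) ?leq_subr //.
by rewrite -ltnS.
Qed.

Lemma fps_mulA : associative fps_mul.
Proof.
move=> f g h; apply/fpsP => n.
transitivity ((trunc n.+1 f * (trunc n.+1 g * trunc n.+1 h))`_n).
  rewrite coefM /=; apply: eq_bigr => i _.
  by rewrite -(@fps_mulE n.+1) ?ltnS ?leq_subr // coef_poly ltn_ord.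
rewrite mulrA coefM /=; apply: eq_bigr => i _.
by rewrite -(@fps_mulE n.+1) ?ltn_ord // coef_poly ltnS leq_subr.
Qed.

Lemma fps_mulC : commutative fps_mul.
Proof.
by move=> f g; apply/fpsP => n; rewrite !(@fps_mulE n.+1) // mulrC.
Qed.

Lemma fps_mul1 : left_id (fpsC 1) fps_mul.
Proof.
move=> f; apply/fpsP => n /=; rewrite big_ord_recl /= mul1r subn0.
by rewrite big1 ?addr0 // => i _; rewrite mul0r.
Qed.

Lemma fps_mulDl : left_distributive fps_mul fps_add.
Proof.
move=> f g h; apply/fpsP => n /=; rewrite -big_split /=.
by apply: eq_bigr => i _; rewrite mulrDl.
Qed.

Lemma fps_one_neq0 : fpsC 1 != 0.
Proof.
by apply/eqP => /fpsP /(_ 0%N) /= /eqP; rewrite oner_eq0.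
Qed.

HB.instance Definition _ := GRing.Zmodule_isComNzRing.Build {fps R}
  fps_mulA fps_mulC fps_mul1 fps_mulDl fps_one_neq0.

(** A power series is invertible iff its constant coefficient is; the
    coefficients g_n of the inverse of f are determined by
    \sum_(i <= n) g_i f_(n - i) = (n == 0), solved for g_n.  As for every
    [unitRingType], the inverse of a non-unit is itself. *)
Definition fps_unit : {pred {fps R}} :=
  [pred f | fps_coef f 0 \is a GRing.unit].

Fixpoint fps_inv_seq f n : seq R :=
  if n isn't m.+1 then [::] else
  let s := fps_inv_seq f m in
  rcons s ((fps_coef f 0)^-1 *
           ((m == 0%N)%:R - \sum_(i < m) s`_i * fps_coef f (m - i))).

Definition fps_inv f : {fps R} :=
  if f \in fps_unit then \fps_n (fps_inv_seq f n.+1)`_n else f.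

Let size_fps_inv_seq f n : size (fps_inv_seq f n) = n.
Proof. by elim: n => //= n IHn; rewrite size_rcons IHn. Qed.

Let nth_fps_inv_seq f n i : (i < n)%N ->
  (fps_inv_seq f n)`_i = (fps_inv_seq f i.+1)`_i.
Proof.
elim: n => // n IHn; rewrite ltnS leq_eqVlt => /orP[/eqP-> // | ltin].
by rewrite -IHn //= nth_rcons size_fps_inv_seq ltin.
Qed.

Lemma fps_mulV : {in fps_unit, left_inverse 1 fps_inv *%R}.
Proof.
move=> f Uf; apply/fpsP => n.
rewrite /fps_inv Uf /= big_ord_recr /= subnn.
rewrite nth_rcons size_fps_inv_seq ltnn eqxx [X in _ + X]mulrC mulVKr //.
have -> : \sum_(i < n) (fps_inv_seq f i.+1)`_i * fps_coef f (n - i)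
  = \sum_(i < n) (fps_inv_seq f n)`_i * fps_coef f (n - i).
  by apply: eq_bigr => i _; rewrite [in RHS]nth_fps_inv_seq.
by rewrite addrC subrK; case: (n == 0)%N.
Qed.

Lemma fps_unitPl f g : g * f = 1 -> fps_unit f.
Proof.
move=> /fpsP /(_ 0%N) /=; rewrite big_ord_recl big_ord0 addr0 subn0 => gf1.
by apply/unitrP; exists (fps_coef g 0); rewrite [_ * fps_coef g 0]mulrC.
Qed.

Lemma fps_inv_out : {in [predC fps_unit], fps_inv =1 id}.
Proof. by move=> f; rewrite inE /= /fps_inv => /negbTE->. Qed.

HB.instance Definition _ := GRing.ComNzRing_hasMulInverse.Build {fps R}
  fps_mulV fps_unitPl fps_inv_out.

End FpsRing.

Arguments fpsX {R}.

Fixpoint gaussian_mersenne (R : realType) (n : nat) : R[i] :=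
  match n with
  | 0 => - ('i%C / 2)
  | 1 => 1
  | (k.+1 as m).+1 => 3 * gaussian_mersenne R m - 2 * gaussian_mersenne R k
  end.

Definition gaussian_mersenne_gf (R : realType) : {fps R[i]} :=
  \fps_j gaussian_mersenne R j.

(* Main.v *)
Require Import Defs.
From mathcomp Require Import all_boot all_order all_algebra.
From mathcomp Require Import reals complex.
From mathcomp Require Import ring.

Import GRing.Theory.
Local Open Scope ring_scope.

(** Multiplying the generating function of a sequence [u] satisfying
    [u (n + 2) = a * u (n + 1) - b * u n] by the reversed characteristic
    polynomial [1 - a z + b z^2] kills every coefficient of index at least 2,
    because the coefficient of index [n + 2] of the product is exactly the
    defect of the recurrence at [n].  What is left is a polynomial of degree at
    most 1 that depends only on [u 0] and [u 1] ([fps_recurrence2]).  Since the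
    reversed characteristic polynomial has constant coefficient 1, it is
    invertible as a power series, and dividing by it gives the closed form.
    For the Gaussian Mersenne numbers [a = 3], [b = 2], [u 0 = -i/2] and
    [u 1 = 1], so the numerator is [-i/2 + (1 + 3i/2) z]. *)

Section FpsCoefficients.
Variable R : comUnitRingType.
Implicit Types (f g : {fps R}) (c : R).

Lemma fps_coefD f g n : fps_coef (f + g) n = fps_coef f n + fps_coef g n.
Proof. by []. Qed.

Lemma fps_coefN f n : fps_coef (- f) n = - fps_coef f n.
Proof. by []. Qed.

Lemma fps_coefCM c f n : fps_coef (fpsC c * f) n = c * fps_coef f n.
Proof.
by rewrite /= big_ord_recl subn0 big1 ?addr0 // => i _; rewrite mul0r.
Qed.

Lemma fps_coefXM f n :
  fps_coef (fpsX * f) n = if n is m.+1 then fps_coef f m else 0.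
Proof.
case: n => [|n] /=; first by rewrite big_ord_recl big_ord0 mul0r addr0.
rewrite !big_ord_recl mul0r add0r mul1r subn1 big1 ?addr0 // => i _.
by rewrite mul0r.
Qed.

Lemma fpsC_nat k : fpsC k%:R = k%:R :> {fps R}.
Proof.
elim: k => [|k IHk]; first by [].
rewrite !mulrS -IHk; apply/fpsP => -[|n] //=; exact/esym/addr0.
Qed.

(** The polynomial [1 - a z + b z^2] encodes the recurrence: its coefficients
    are the weights of [u (n + 2)], [u (n + 1)] and [u n] in the defect, so the
    product is a polynomial carrying the initial values alone. *)
Lemma fps_recurrence2 (u : nat -> R) (a b : R) :
    (forall n, u n.+2 = a * u n.+1 - b * u n) ->
  (\fps_j u j) * (1 - fpsC a * fpsX + fpsC b * fpsX ^+ 2)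
    = fpsC (u 0%N) + fpsC (u 1%N - a * u 0%N) * fpsX.
Proof.
move=> u_rec; set f := \fps_j u j.
(* Each product now has a constant or the variable on the left, so its
   coefficients involve no convolution sum. *)
have -> : f * (1 - fpsC a * fpsX + fpsC b * fpsX ^+ 2)
    = f - fpsC a * (fpsX * f) + fpsC b * (fpsX * (fpsX * f)).
  by rewrite mulrDr mulrBr mulr1 expr2 ![f * _]mulrC -!mulrA.
apply/fpsP => n; rewrite !(fps_coefD, fps_coefN, fps_coefCM, fps_coefXM).
(* At index n + 2 the goal is the recurrence itself; at 0 and 1 it is where the
   initial values enter. *)
case: n => [|[|n]]; rewrite ?fps_coefXM /=; [by ring | by ring |].
by rewrite u_rec; ring.
Qed.

Lemma fps_charpoly_unit (a b : R) :
  1 - fpsC a * fpsX + fpsC b * fpsX ^+ 2 \is a @GRing.unit {fps R}.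
Proof.
set q : {fps R} := (X in X \is a _).
(* For power series, being a unit unfolds to the constant coefficient being
   a unit. *)
rewrite -[_ \is a _]/(fps_coef q 0 \is a GRing.unit).
suff -> : fps_coef q 0 = 1 by exact: unitr1.
rewrite /q expr2 !(fps_coefD, fps_coefN, fps_coefCM, fps_coefXM) /=.
by ring.
Qed.
End FpsCoefficients.

Theorem theorem3p5 (R : realType) :
  gaussian_mersenne_gf R =
    (fpsX + fpsC 'i%C * (fpsC (3 / 2) * fpsX - fpsC (1 / 2)))
    / (1 - 3 * fpsX + 2 * fpsX ^+ 2).
Proof.
rewrite -(fpsC_nat _ 3) -(fpsC_nat _ 2).
rewrite -[LHS](mulrK (fps_charpoly_unit _ 3 2)) fps_recurrence2 //.
congr (_ / _).
apply/fpsP => n; rewrite !(fps_coefD, fps_coefN, fps_coefCM) /=.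
by case: n => [|[|n]] /=; ring.
Qed.
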